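(* Let $a_i,b_i>0$, $\eta\in[0,1)$, $T>0$, $W_i,W_j>0$ and $\Delta_i\in\mathbb{R}$ be fixed. Then the dictator's optimal choice $s^*\in[0,1]$ weakly increases when $\Delta_j$ increases. That is, for $\Delta_j\in\mathbb{R}$ let $s^*(\Delta_j)$ denote the maximizer over $s\in[0,1]$ of the dictator's utility $U_i^D(s)$ (defined in the context); then $\Delta_j\le\Delta_j'$ implies $s^*(\Delta_j)\le s^*(\Delta_j')$.
   Context: Setting: a Dictator Game with a dictator $i$ and a recipient $j$. $W_i,W_j>0$ are the two individuals' sums of wages over two sub-periods, and $\Delta_i,\Delta_j\in\mathbb{R}$ are the differences between their second and first sub-period wages. The dictator chooses $s\in[0,1]$, keeping the share $s$ of a tax account $T>0$ and giving the share $1-s$ to the recipient. The parameters $a_i,b_i>0$ are the weights on personal and social concerns, and $\eta\in[0,1)$ is the loss-aversion parameter. The dictator's utility, as a function of $s$, is $$ U_i^D(s)=\begin{cases} a_i\big(W_i+sT+\eta(\Delta_i+sT)\big)-b_i\Big[\big(\tfrac12(W_i-W_j+2sT-T)\big)^2+\big(\tfrac12(\Delta_i-\Delta_j+2sT-T)\big)^2\Big] & \text{if } \Delta_i+sT<0,\\[1mm] a_i(W_i+sT)-b_i\Big[\big(\tfrac12(W_i-W_j+2sT-T)\big)^2+\big(\tfrac12(\Delta_i-\Delta_j+2sT-T)\big)^2\Big] & \text{if } \Delta_i+sT\ge 0. \end{cases} $$ *)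

(* Defs.v *)
(* MathComp world; the real line is an arbitrary [R : realType]. *)
From mathcomp Require Import all_boot all_order all_algebra.
From mathcomp Require Import reals.

Set Implicit Arguments.
Unset Strict Implicit.
Unset Printing Implicit Defensive.

Import Order.TTheory GRing.Theory Num.Theory.

Local Open Scope ring_scope.

Definition inequality_cost (R : realType) (T Wi Wj Di Dj s : R) : R :=
  (2^-1 * (Wi - Wj + 2 * s * T - T)) ^+ 2
  + (2^-1 * (Di - Dj + 2 * s * T - T)) ^+ 2.

Definition dictator_utility (R : realType)
    (a b eta T Wi Wj Di Dj s : R) : R :=
  if Di + s * T < 0
  then a * (Wi + s * T + eta * (Di + s * T))
       - b * inequality_cost T Wi Wj Di Dj s
  else a * (Wi + s * T) - b * inequality_cost T Wi Wj Di Dj s.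

Definition is_maximizer01 (R : realType) (f : R -> R) (s : R) : Prop :=
  0 <= s <= 1 /\ forall t : R, 0 <= t <= 1 -> f t <= f s.

(* Main.v *)
(** The loss term equals [a eta min(Di + s T, 0)], so up to a constant the utility is [2 b T^2]
    times [- (s - m)^2 + 2 d min(s - k, 0)] with kink [k = - Di / T] and [d >= 0]. This function
    is strongly concave and peaks at the median of [m], [m + d] and [k]; projecting the peak on
    [[0, 1]] gives the unique maximizer. Monotonicity is a revealed-preference argument: the
    cross term of [s] and [Dj] in the utility is [b T s Dj], so the utility has increasing
    differences in [(s, Dj)]. *)
Require Import Defs.
From mathcomp Require Import all_boot all_order all_algebra.
From mathcomp Require Import reals.
From mathcomp Require Import ring lra.

Import Order.TTheory GRing.Theory Num.Theory.

Local Open Scope ring_scope.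

(** The margin [(t - s) ^+ 2] is strong concavity: adding [t ^+ 2] to the function leaves it
    concave. Uniqueness of the maximizer will come from this margin. *)
Lemma kinked_parabola_peak (R : realType) (m d k : R) (hd : 0 <= d) :
  exists2 s : R, 0 <= s <= 1 &
    forall t : R, 0 <= t <= 1 ->
      - (t - m) ^+ 2 + 2 * d * Num.min (t - k) 0
      <= - (s - m) ^+ 2 + 2 * d * Num.min (s - k) 0 - (t - s) ^+ 2.
Proof.
(* The branch right of the kink has vertex [m], the left one [m + d]; if neither vertex lies on its
   own side, the peak is the kink. *)
have [x hx] : exists x : R,
    [\/ x = m /\ k <= m, x = k /\ m <= k <= m + d | x = m + d /\ m + d <= k].
  have [hk|/ltW hk] := leP k m; first by exists m; apply: Or31.
  have [hkd|/ltW hkd] := leP k (m + d); first by exists k; apply: Or32; rewrite hk.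
  by exists (m + d); apply: Or33.
have [s hs] : exists s : R, [\/ s = 0 /\ x <= 0, s = x /\ 0 <= x <= 1 | s = 1 /\ 1 <= x].
  have [h0|/ltW h0] := leP x 0; first by exists 0; apply: Or31.
  have [h1|/ltW h1] := leP x 1; first by exists x; apply: Or32; rewrite h0.
  by exists 1; apply: Or33.
exists s; first by case: hs => -[-> //]; rewrite lexx ler01.
move=> t /andP[t0 t1].
have kinkE r : (Num.min (r - k) 0 = r - k /\ r <= k) \/ (Num.min (r - k) 0 = 0 /\ k <= r).
  by have [h|/ltW h] := leP (r - k) 0; [left|right]; split=> //; lra.
case: (kinkE t) => -[-> ht]; case: (kinkE s) => -[-> hsk];
  (case: hx => -[ex]; [move=> hk|move=> /andP[hk hkd]|move=> hk]);
  (case: hs => -[es]; [move=> hx|move=> /andP[h0 h1]|move=> hx]);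
  by subst s x; nra.
Qed.

Lemma dictator_utilityE (R : realType) (a b eta T Wi Wj Di Dj s : R) :
  dictator_utility a b eta T Wi Wj Di Dj s =
  a * (Wi + s * T) + a * eta * Num.min (Di + s * T) 0
  - b * inequality_cost T Wi Wj Di Dj s.
Proof. by rewrite /dictator_utility; case: ltP => _; ring. Qed.

Lemma dictator_utility_peak (R : realType) (a b eta T Wi Wj Di Dj : R)
    (ha : 0 < a) (hb : 0 < b) (heta : 0 <= eta) (hT : 0 < T) :
  exists2 s : R, 0 <= s <= 1 &
    forall t : R, 0 <= t <= 1 ->
      dictator_utility a b eta T Wi Wj Di Dj t
      <= dictator_utility a b eta T Wi Wj Di Dj s - 2 * b * T ^+ 2 * (t - s) ^+ 2.
Proof.
(* [m] is the vertex of the utility without its loss term, [d] the shift of the vertex on the loss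
   side, and [k] the zero of [Di + s * T]. *)
pose m := (a - b * (Wi - Wj - T + (Di - Dj - T))) / (4 * b * T).
pose d := a * eta / (4 * b * T).
pose k := - Di / T.
have T0 : T != 0 by rewrite gt_eqF.
have b0 : b != 0 by rewrite gt_eqF.
have hd : 0 <= d by rewrite /d divr_ge0 // !mulr_ge0 // ltW.
have hB : 0 <= 2 * b * T ^+ 2 by rewrite !mulr_ge0 // ?exprn_ge0 // ltW.
have [s hs hmax] := kinked_parabola_peak _ m d k hd.
pose C := a * Wi - b * (2^-1 ^+ 2 * ((Wi - Wj - T) ^+ 2 + (Di - Dj - T) ^+ 2))
          + 2 * b * T ^+ 2 * m ^+ 2.
have UE r : dictator_utility a b eta T Wi Wj Di Dj r =
    C + 2 * b * T ^+ 2 * (- (r - m) ^+ 2 + 2 * d * Num.min (r - k) 0).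
  have minE : Num.min (Di + r * T) 0 = T * Num.min (r - k) 0.
    rewrite minr_pMr ?ltW // mulr0; congr Num.min.
    by rewrite /k; field.
  rewrite dictator_utilityE minE /inequality_cost /C /d /m.
  by field; rewrite T0 b0.
exists s => // t ht.
by clearbody C; rewrite !UE -addrA lerD2l -mulrBr ler_wpM2l // hmax.
Qed.

Lemma dictator_maximizer_unique (R : realType) (a b eta T Wi Wj Di Dj : R)
    (ha : 0 < a) (hb : 0 < b) (heta : 0 <= eta) (hT : 0 < T) :
  exists! s : R, is_maximizer01 (dictator_utility a b eta T Wi Wj Di Dj) s.
Proof.
have [s hs hmax] := dictator_utility_peak _ _ _ _ _ Wi Wj Di Dj ha hb heta hT.
have hB : 0 < 2 * b * T ^+ 2 by rewrite !mulr_gt0.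
exists s; split=> [|t [ht tmax]].
  split=> // t /hmax /le_trans; apply.
  by rewrite gerBl mulr_ge0 ?sqr_ge0 // ltW.
(* Both points being optimal, the margin at [t] must be nonpositive. *)
have := le_trans (tmax s hs) (hmax t ht).
rewrite lerBrDl gerDr pmulr_rle0 // => hle.
by apply/esym/eqP; rewrite -subr_eq0 -sqrf_eq0 eq_le hle sqr_ge0.
Qed.

(** The loss term is free of [Dj], so it cancels in the double difference and no case split at the
    kink arises. *)
Lemma dictator_utility_increasing_differences (R : realType)
    (a b eta T Wi Wj Di Dj Dj' s s' : R) :
  (dictator_utility a b eta T Wi Wj Di Dj' s'
     - dictator_utility a b eta T Wi Wj Di Dj' s)
  - (dictator_utility a b eta T Wi Wj Di Dj s'
     - dictator_utility a b eta T Wi Wj Di Dj s)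
  = b * T * ((Dj' - Dj) * (s' - s)).
Proof. by rewrite !dictator_utilityE /inequality_cost; field. Qed.

Theorem proposition4 (R : realType) (a b eta T Wi Wj Di : R)
    (ha : 0 < a) (hb : 0 < b) (heta : 0 <= eta < 1) (hT : 0 < T)
    (hWi : 0 < Wi) (hWj : 0 < Wj) :
  (forall Dj : R, exists! s : R,
      is_maximizer01 (dictator_utility a b eta T Wi Wj Di Dj) s)
  /\
  (forall Dj Dj' s s' : R,
      is_maximizer01 (dictator_utility a b eta T Wi Wj Di Dj) s ->
      is_maximizer01 (dictator_utility a b eta T Wi Wj Di Dj') s' ->
      Dj <= Dj' -> s <= s').
Proof.
have /andP[eta0 _] := heta.
have uniq Dj := dictator_maximizer_unique _ _ _ _ _ Wi Wj Di Dj ha hb eta0 hT.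
split=> // Dj Dj' s s' ms ms' le_Dj.
(* At equal parameters the cross term vanishes and says nothing about [s] and [s']; uniqueness
   settles this case. *)
have [eq_Dj|neq_Dj] := eqVneq Dj Dj'.
  rewrite -eq_Dj in ms'.
  have [r [_ r_uniq]] := uniq Dj.
  by rewrite -(r_uniq s ms) (r_uniq s' ms').
have lt_Dj : 0 < Dj' - Dj by rewrite subr_gt0 lt_neqAle neq_Dj.
have [hs smax] := ms; have [hs' s'max] := ms'.
(* Scaling [s' - s] by positive factors turns it into the double difference, whose first part is
   nonnegative by optimality of [s'] and second nonpositive by that of [s]. *)
rewrite -subr_ge0 -(pmulr_rge0 _ lt_Dj) -(pmulr_rge0 _ (mulr_gt0 hb hT)).
rewrite -(dictator_utility_increasing_differences _ a b eta T Wi Wj Di).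
by rewrite subr_ge0 (@le_trans _ _ 0) ?subr_le0 ?subr_ge0 ?smax ?s'max.
Qed.
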